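(* Let $X$ be a topological space, $D\subset X$ a dense set, $\kappa\ge |D|$ an infinite cardinal, and $\mathcal{I}\subset\mathcal{P}(X)$ a family of subsets of $X$. If for each $x\in D$ and for every $\mathcal{Y}\in S_\kappa(\mathcal{I})$ there is a set $Z\in\mathcal{I}$ such that $\left(\bigcup\mathcal{Y}\right)\cap Z=\emptyset$ and $x\in\overline{Z}$, then $X$ is $\kappa$-resolvable.
   Context: For a cardinal $\kappa>1$, a topological space is $\kappa$-resolvable if it contains $\kappa$ many pairwise disjoint dense subsets. For a family of sets $\mathcal{A}$ and a cardinal $\kappa$, $S_\kappa(\mathcal{A})$ denotes the collection of all subfamilies $\mathcal{A}'\subset\mathcal{A}$ with $|\mathcal{A}'|<\kappa$ whose members are pairwise disjoint. $\mathcal{P}(X)$ is the power set of $X$. *)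

(* Defs.v *)
From mathcomp Require Import all_boot all_order.
From mathcomp Require Import boolp classical_sets functions cardinality.
From mathcomp Require Import filter topology.

Set Implicit Arguments.
Unset Strict Implicit.
Unset Printing Implicit Defensive.

Local Open Scope classical_set_scope.
Local Open Scope card_scope.

(* A cardinal kappa is represented by a type K (its cardinality). *)

Definition card_lt (T U : Type) (A : set T) (B : set U) : Prop :=
  (A #<= B) /\ ~ (B #<= A).

(* The kappa many dense sets are given as a family indexed by K. For nonempty X,
   dense sets are nonempty, so disjointness makes the family injective and its
   range has exactly kappa members; the empty space, whose only subset is dense,
   counts as kappa-resolvable for every kappa. *)
Definition resolvable (K : Type) (X : topologicalType) : Prop :=
  exists A : K -> set X, (forall k, dense (A k)) /\
    (forall i j, i <> j -> A i `&` A j = set0).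

Definition small_disjoint_subfamilies (K T : Type) (F : set (set T)) :
    set (set (set T)) :=
  [set F' | [/\ F' `<=` F,
        card_lt F' [set: K] &
        forall A B, F' A -> F' B -> A <> B -> A `&` B = set0]].

(* Main.v *)
(* Since kappa * kappa = kappa, the set of pairs (x, k) with x in D and k < kappa
   can be well-ordered so that every proper initial segment has fewer than kappa
   elements. Transfinite recursion along this order picks pairwise disjoint
   members Z (x, k) of the family with x in the closure of Z (x, k); for each k
   the union of the sets Z (x, k) over x in D is then dense. *)
Require Import Defs.
From mathcomp Require Import all_boot all_order.
From mathcomp Require Import boolp classical_sets functions cardinality.
From mathcomp Require Import filter topology.
From mathcomp Require wochoice.

Local Open Scope classical_set_scope.
Local Open Scope card_scope.

(** * Comparison of cardinals *)

(** Sending each [b] to a chosen point of [A] related to it (to [a0] if there is none) gives a map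
    whose image of [B] covers [A]. Hence [R] may be multivalued, and Zorn arguments can work with
    bare graphs. *)
Lemma rel_card_le {T U : Type} (A : set T) (B : set U) (R : T -> U -> Prop) :
  (forall a, A a -> exists2 b, B b & R a b) ->
  (forall a a' b, A a -> A a' -> B b -> R a b -> R a' b -> a = a') ->
  A #<= B.
Proof.
move=> Rtot Rinj.
have [->|/set0P[a0 Aa0]] := eqVneq A set0; first exact: card_ge0.
have /choice[g gP] b : exists a, (exists2 a', A a' & R a' b) -> A a /\ R a b.
  by have [[a Aa Rab]|nR] := pselect (exists2 a, A a & R a b);
    [exists a | exists a0].
apply: card_le_trans (card_image_le g B); apply: subset_card_le => a Aa.
have [b Bb Rab] := Rtot a Aa; exists b => //.
by have [|Agb Rgb] := gP b; [exists a | apply: Rinj Rgb Rab].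
Qed.

Lemma card_le_inj {T U : Type} {A : set T} {B : set U} (u0 : U) :
  A #<= B -> exists f : T -> U, (forall a, A a -> B (f a)) /\
    (forall a a', A a -> A a' -> f a = f a' -> a = a').
Proof.
elim/Ppointed: U => U in B u0 *; first by case: (no u0).
move=> /pcard_leP[f]; exists f; split=> [a Aa|a a' Aa Aa' ff'].
  exact: 'funS_f.
by apply: 'inj_f ff'; apply: mem_set.
Qed.

(** Zorn's lemma is applied to the sets [A] with [P (A0]|[A)]: the empty chain is then bounded by
    [A0] itself, so only nonempty chains need a hypothesis on [P]. *)
Lemma Zorn_bigcup_above {T : Type} (P : set (set T)) (A0 : set T) :
  P A0 ->
  (forall F : set (set T), F !=set0 -> F `<=` P -> total_on F subset ->
    P (\bigcup_(X in F) X)) ->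
  exists M, [/\ A0 `<=` M, P M & forall N, M `<=` N -> P N -> N `<=` M].
Proof.
move=> PA0 Pchain.
have [|M [PM maxM]] := @Zorn_bigcup _ [set A | P (A0 `|` A)].
  move=> F FP Ftot /=; have [->|/set0P[X0 FX0]] := eqVneq F set0.
    by rewrite bigcup_set0 setU0.
  have -> : A0 `|` \bigcup_(X in F) X
          = \bigcup_(Y in [set A0 `|` X | X in F]) Y.
    apply/seteqP; split=> [t [A0t|[X FX Xt]]|t [_ [X FX <-]] [A0t|Xt]].
    - by exists (A0 `|` X0); [exists X0|left].
    - by exists (A0 `|` X); [exists X|right].
    - by left.
    - by right; exists X.
  apply: Pchain => [|_ [X FX <-]|_ _ [X FX <-] [Y FY <-]].
  - by exists (A0 `|` X0), X0.
  - exact: FP.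
  - by have [XY|YX] := Ftot _ _ FX FY; [left|right]; apply: setUS.
exists (A0 `|` M); split=> // N MN PN; apply: contrapT => nNM.
apply: (maxM N); last first.
  by rewrite /= (setUidPr _ _).2 // => t A0t; apply: MN; left.
split=> [t Mt|NM]; first by apply: MN; right.
by apply: nNM => t /NM; right.
Qed.

(** A maximal partial bijection between [A] and [B] exhausts one side; otherwise a pair of missed
    points could be added to it. *)
Lemma card_le_total {T U : Type} (A : set T) (B : set U) :
  A #<= B \/ B #<= A.
Proof.
pose P : set (set (T * U)) := [set G |
  (forall p, G p -> A p.1 /\ B p.2) /\
  (forall p q, G p -> G q -> (p.1 = q.1 <-> p.2 = q.2))].
have [//||M [_ [MAB Mbij] maxM]] := Zorn_bigcup_above P set0.
- move=> F _ FP Ftot; split=> [p [X FX Xp]|p q [X FX Xp] [Y FY Yq]].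
    exact: (FP _ FX).1.
  have [XY|YX] := Ftot _ _ FX FY.
    by apply: (FP _ FY).2 => //; apply: XY.
  by apply: (FP _ FX).2 => //; apply: YX.
have [[a [Aa aM]]|ntot] := pselect (exists a, A a /\ forall b, ~ M (a, b));
  last first.
  left; apply: (@rel_card_le _ _ A B (fun a b => M (a, b))) => [a Aa|].
    apply: contrapT => nb; apply: ntot; exists a; split=> // b Mab.
    by apply: nb; exists b => //; exact: (MAB _ Mab).2.
  by move=> a a' b _ _ _ Mab Ma'b; apply: (Mbij _ _ Mab Ma'b).2.
right; apply: (@rel_card_le _ _ B A (fun b a => M (a, b))) => [b Bb|];
    last first.
  by move=> b b' a' _ _ _ Mab Mab'; apply: (Mbij _ _ Mab Mab').1.
apply: contrapT => nb; apply: (aM b).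
have bM a' : ~ M (a', b).
  by move=> Mab; apply: nb; exists a' => //; exact: (MAB _ Mab).1.
apply: (maxM (M `|` [set (a, b)])); [exact: subsetUl| |by right].
split=> [p [/MAB//|->//]|p q [Mp|->] [Mq|->]] //=; first exact: Mbij.
- by split=> e; exfalso; [apply: (aM p.2)|apply: (bM p.1)];
    rewrite -e -surjective_pairing.
- by split=> e; exfalso; [apply: (aM q.2)|apply: (bM q.1)];
    rewrite e -surjective_pairing.
Qed.

(** * The square of an infinite cardinal *)

(* The relation [G (a, b, c)] is the graph of an injective multivalued map
   from [A * A] to [A], where [A] is read off the diagonal. *)
Definition rel_field {T : Type} (G : set (T * T * T)) : set T :=
  [set a | exists c, G (a, a, c)].

Definition square_embedding {T : Type} (G : set (T * T * T)) : Prop :=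
  [/\ forall p q c, G (p, c) -> G (q, c) -> p = q,
      forall a b c, G (a, b, c) ->
        [/\ rel_field G a, rel_field G b & rel_field G c] &
      forall a b, rel_field G a -> rel_field G b -> exists c, G (a, b, c)].

Lemma square_embedding_bigcup {T : Type} (F : set (set (T * T * T))) :
  F `<=` square_embedding -> total_on F subset ->
  square_embedding (\bigcup_(X in F) X).
Proof.
move=> FP Ftot.
have fldS X a : F X -> rel_field X a -> rel_field (\bigcup_(X in F) X) a.
  by move=> FX [c Xc]; exists c, X.
split=> [p q c [X FX Xp] [Y FY Yq]|a b c [X FX Xabc]|a b].
- have [XY|YX] := Ftot _ _ FX FY.
    by have [inj _ _] := FP _ FY; apply: inj Yq; apply: XY.
  by have [inj _ _] := FP _ FX; apply: inj Xp (YX _ Yq).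
- have [_ fld _] := FP _ FX; have [Xa Xb Xc] := fld _ _ _ Xabc.
  by split; apply: (fldS X).
- move=> [c [X FX Xa]] [d [Y FY Yb]].
  have [XY|YX] := Ftot _ _ FX FY.
    have [_ _ tot] := FP _ FY.
    have [||e Ye] := tot a b; [by exists c; apply: XY|by exists d|].
    by exists e, Y.
  have [_ _ tot] := FP _ FX.
  have [||e Xe] := tot a b; [by exists c|by exists d; apply: YX|].
  by exists e, X.
Qed.

(** This is the starting point for Zorn's lemma: a copy of a pairing function on the naturals, which
    forces the maximal field to be infinite. *)
Lemma square_embedding_nat {T : Type} (h : nat -> T) : injective h ->
  square_embedding
    [set (h p.1, h p.2, h (choice.pickle p)) | p in [set: nat * nat]].
Proof.
move=> h_inj; set G := image _ _.
have fld n : rel_field G (h n) by exists (h (choice.pickle (n, n))), (n, n).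
split=> [p q c [x _ [<- <-]] [y _ [<- /h_inj e]]|a b c [x _ [<- <- <-]]|a b].
- by rewrite (pcan_inj choice.pickleK e).
- by split.
- move=> [c [x _ [<- _ _]]] [d [y _ [<- _ _]]].
  by exists (h (choice.pickle (x.1, y.1))), (x.1, y.1).
Qed.

(* Any two elements [t false != t true] of the field [A] tag the four squares
   of [(A `|` g @` A) * (A `|` g @` A)]. *)
Lemma square_embedding_extend {T : Type} (G : set (T * T * T))
    (t : bool -> T) (g : T -> T) :
  square_embedding G -> injective t -> (forall i, rel_field G (t i)) ->
  (forall a, rel_field G a -> ~ rel_field G (g a)) ->
  (forall a b, rel_field G a -> rel_field G b -> g a = g b -> a = b) ->
  exists N, [/\ G `<=` N, square_embedding N & ~ N `<=` G].
Proof.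
move=> [Ginj Gfld Gtot] t_inj tA gA g_inj; set A := rel_field G.
have /choice[f fP] (p : T * T) :
    exists c, A p.1 -> A p.2 -> A c /\ G (p.1, p.2, c).
  have [[A1 A2]|nA] := pselect (A p.1 /\ A p.2); last first.
    by exists (t true) => A1 A2; case: nA.
  have [c Gc] := Gtot _ _ A1 A2; exists c => _ _; split=> //.
  by have [] := Gfld _ _ _ Gc.
have fA a b : A a -> A b -> A (f (a, b)).
  by move=> Aa Ab; have [] := fP (a, b) Aa Ab.
have fG a b : A a -> A b -> G (a, b, f (a, b)).
  by move=> Aa Ab; have [] := fP (a, b) Aa Ab.
have f_inj a b a' b' : A a -> A b -> A a' -> A b' ->
    f (a, b) = f (a', b') -> a = a' /\ b = b'.
  move=> Aa Ab Aa' Ab' e; have := fG _ _ Aa Ab; rewrite e => Gab.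
  by have [-> ->] := Ginj _ _ _ Gab (fG _ _ Aa' Ab').
(* [E false] and [E true] parametrize [A] and its disjoint copy under [g]. *)
pose E (i : bool) := if i then g else id.
have E_inj i j a b : A a -> A b -> E i a = E j b -> i = j /\ a = b.
  case: i; case: j => /= Aa Ab e; split=> //; do ?[exact: g_inj].
  - by case: (gA _ Aa); rewrite e.
  - by case: (gA _ Aa); rewrite e.
  - by case: (gA _ Ab); rewrite -e.
  - by case: (gA _ Ab); rewrite -e.
(* The outer [g] puts every new value outside [A], away from the values of [G]; the pair
   [f (t i, t j)] records which of the squares the argument lies in. *)
pose code i j a b := g (f (f (a, b), f (t i, t j))).
(* The condition [i || j] leaves out the square of [A], where [G] is already defined. *)
pose N := G `|` [set p | exists i j a b, [/\ A a, A b, i || j &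
  p = (E i a, E j b, code i j a b)]].
have GN : G `<=` N by exact: subsetUl.
have NE i a : A a -> rel_field N (E i a).
  case: i => Aa; last by have [c Gc] := Aa; exists c; left.
  by exists (code true true a a); right; exists true, true, a, a.
have NA a : rel_field N a -> exists i a', A a' /\ a = E i a'.
  move=> [c [Ga|[i [j [b [b' [Ab Ab' _ [-> _ _]]]]]]]].
    by exists false, a; split=> //; exists c.
  by exists i, b.
have codeA i j a b : A a -> A b -> A (f (f (a, b), f (t i, t j))).
  by move=> Aa Ab; apply: (fA); apply: (fA) => //; apply: tA.
exists N; split=> //; first split.
- move=> p q c [Gp|[i [j [a [b [Aa Ab ij [-> ec]]]]]]]
              [Gq|[k [l [a' [b' [Aa' Ab' kl [-> ec']]]]]]].
  + exact: Ginj Gp Gq.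
  + exfalso; case: p Gp => p1 p2 /Gfld[_ _]; rewrite ec'.
    by apply: gA; apply: codeA.
  + exfalso; case: q Gq => q1 q2 /Gfld[_ _]; rewrite ec.
    by apply: gA; apply: codeA.
  + have e : f (f (a, b), f (t i, t j)) = f (f (a', b'), f (t k, t l)).
      by apply: g_inj; [exact: codeA|exact: codeA|rewrite -[LHS]ec].
    have [e1 e2] : f (a, b) = f (a', b') /\ f (t i, t j) = f (t k, t l).
      by apply: f_inj e; apply: fA => //; apply: tA.
    have [-> ->] := f_inj _ _ _ _ Aa Ab Aa' Ab' e1.
    by have [/t_inj -> /t_inj ->] :=
      f_inj _ _ _ _ (tA _) (tA _) (tA _) (tA _) e2.
- move=> a b c [/Gfld[Aa Ab Ac]|[i [j [a' [b' [Aa Ab ij [-> -> ->]]]]]]].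
    by split; [apply: (NE false a)|apply: (NE false b)|apply: (NE false c)].
  by split; [exact: NE|exact: NE|apply: (NE true); exact: codeA].
- move=> _ _ /NA[i [a [Aa ->]]] /NA[j [b [Ab ->]]].
  have [ij|] := boolP (i || j).
    by exists (code i j a b); right; exists i, j, a, b.
  rewrite negb_or => /andP[/negPf -> /negPf ->].
  by have [c Gc] := Gtot _ _ Aa Ab; exists c; left.
- move=> NG; have [c] := NE true _ (tA true).
  by move=> /NG Gc; apply: (gA _ (tA true)); exists c.
Qed.

(** Let [A] be the field of a maximal square embedding. If [A] embedded in its complement, the
    extension lemma would contradict maximality. So the complement embeds in [A], hence all of [K]
    does, and the square of [A] embeds in [A]. *)
Lemma infinite_card_le_square (K : Type) :
  infinite_set [set: K] -> [set: K * K] #<= [set: K].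
Proof.
move=> Kinf; have [k0 _] : [set: K] !=set0 by apply: infinite_setN0.
have [h [_ h_inj]] := card_le_inj k0 ((infiniteP _).1 Kinf).
have hI : injective h by move=> m n; apply: h_inj.
have [|G [G0G Gsq maxG]] := Zorn_bigcup_above _ _ (square_embedding_nat h hI).
  by move=> F _; apply: square_embedding_bigcup.
set A := rel_field G.
have Ah n : A (h n).
  by exists (h (choice.pickle (n, n))); apply: G0G; exists (n, n).
have A2A : A `*` A #<= A.
  have [Ginj Gfld Gtot] := Gsq.
  apply: (@rel_card_le _ _ _ _ (fun p c => G (p, c))) => [[a b] [/= Aa Ab]|].
    by have [c Gc] := Gtot _ _ Aa Ab; exists c => //; have [] := Gfld _ _ _ Gc.
  by move=> p q c _ _ _; apply: Ginj.
have [leA|leCA] := card_le_total A (~` A).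
  have [g [gA g_inj]] := card_le_inj k0 leA.
  have [||//|//|N [GN Nsq []]] :=
    square_embedding_extend G (h \o nat_of_bool) g Gsq.
  - by move=> i j /hI; case: i; case: j.
  - by move=> i; apply: Ah.
  exact: maxG.
have [f [fA f_inj]] := card_le_inj k0 A2A.
have [k [kA k_inj]] := card_le_inj k0 leCA.
have f_inj2 a b a' b' : A a -> A b -> A a' -> A b' ->
    f (a, b) = f (a', b') -> a = a' /\ b = b'.
  by move=> Aa Ab Aa' Ab'
    /(f_inj (a, b) (a', b') (conj Aa Ab) (conj Aa' Ab'))[].
(* The tags [h 0] and [h 1] keep the images of [A] and of its complement apart. *)
pose e x := if pselect (A x) then f (x, h 0) else f (k x, h 1).
have eA x : A (e x).
  by rewrite /e; case: pselect => Ax; apply: fA; split=> //=; apply: kA.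
have e_inj x y : e x = e y -> x = y.
  rewrite /e; case: pselect => Ax; case: pselect => Ay.
  - by move=> /(f_inj2 _ _ _ _ Ax (Ah 0) Ay (Ah 0))[].
  - by move=> /(f_inj2 _ _ _ _ Ax (Ah 0) (kA _ Ay) (Ah 1))[_ /hI].
  - by move=> /(f_inj2 _ _ _ _ (kA _ Ax) (Ah 1) Ay (Ah 0))[_ /hI].
  - move=> /(f_inj2 _ _ _ _ (kA _ Ax) (Ah 1) (kA _ Ay) (Ah 1))[+ _].
    exact: k_inj.
apply: (@rel_card_le _ _ _ _ (fun p c => c = f (e p.1, e p.2))).
  by move=> p _; exists (f (e p.1, e p.2)).
move=> [a b] [a' b'] c _ _ _ -> /=.
by move=> /(f_inj2 _ _ _ _ (eA _) (eA _) (eA _) (eA _))[/e_inj-> /e_inj->].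
Qed.

(** * Well-orders with small initial segments *)

Lemma wf_total_exists (K : Type) : exists lt : K -> K -> Prop,
  well_founded lt /\ forall x y, [\/ x = y, lt x y | lt y x].
Proof.
elim/Peq: K => K; have [R Rwo] := wochoice.well_ordering_principle K.
have Rch : wochoice.wo_chain R predT by move=> B _; apply: Rwo.
have Rtot := wochoice.wo_chainW Rch.
have Ranti := wochoice.wo_chain_antisymmetric Rch.
exists (fun x y => R x y /\ x <> y); split=> [x|x y]; last first.
  have [->|/eqP xy] := eqVneq x y; first exact: Or31.
  have /orP[Rxy|Ryx] := Rtot x y isT isT; first exact: Or32.
  by apply: Or33; split=> // yx; apply: xy.
apply: contrapT => nAx.
(* A least inaccessible point would have only accessible strict predecessors, hence be
   accessible. *)
pose B : {pred K} := fun x => `[< ~ Acc (fun x y => R x y /\ x <> y) x >].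
have [|z [[Bz minz] _]] := Rwo B; first by exists x; apply/asboolP.
have /asboolP := Bz; apply; constructor => y [Ryz yz].
apply: contrapT => nAy; apply: yz; apply: Ranti => //.
by rewrite Ryz; apply: minz; apply/asboolP.
Qed.

Lemma wf_total_pullback {T U : Type} (lt : U -> U -> Prop) (e : T -> U) :
  well_founded lt -> (forall x y, [\/ x = y, lt x y | lt y x]) ->
  injective e ->
  well_founded (fun x y => lt (e x) (e y)) /\
  forall x y, [\/ x = y, lt (e x) (e y) | lt (e y) (e x)].
Proof.
move=> wf tot e_inj; split=> [x|x y]; last first.
  by have [/e_inj|?|?] := tot (e x) (e y);
    [exact: Or31|exact: Or32|exact: Or33].
have [u ux] : exists u, u = e x by exists (e x).
elim/(well_founded_induction wf): u x ux => u IH x ux.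
by constructor=> y yx; apply: (IH (e y)); rewrite // ux.
Qed.

(** Take a well-order of [K]. If some segment has size kappa, embed [K] in the segment below the
    least such point and pull the order back: all segments become small. Finally pull back from [K]
    to [T]. *)
Lemma wf_small_segments {T K : Type} (k0 : K) : [set: T] #<= [set: K] ->
  exists lt : T -> T -> Prop,
    [/\ well_founded lt, forall x y, [\/ x = y, lt x y | lt y x] &
        forall a, card_lt [set b | lt b a] [set: K]].
Proof.
move=> TK.
have [i [_ i_inj]] := card_le_inj k0 TK.
have iI : injective i by move=> x y; apply: i_inj.
suff [lt [wf tot small]] : exists lt : K -> K -> Prop,
    [/\ well_founded lt, forall x y, [\/ x = y, lt x y | lt y x] &
        forall a, ~ ([set: K] #<= [set b | lt b a])].
  have [wf' tot'] := wf_total_pullback lt i wf tot iI.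
  exists (fun x y => lt (i x) (i y)); split=> // a; split.
    exact: card_le_trans (subset_card_le (@subsetT _ _)) TK.
  move=> /card_le_trans le; apply: (small (i a)); apply: le.
  apply: (@rel_card_le _ _ _ _ (fun x y => y = i x)) => [x xa|].
    by exists (i x).
  by move=> x y z _ _ _ -> /iI.
have [lt [wf tot]] := wf_total_exists K.
have [small|] := pselect (forall a, ~ ([set: K] #<= [set b | lt b a])).
  by exists lt.
move=> /existsNP[a]; elim/(well_founded_induction wf): a => a IH /contrapT leK.
have [[b ba bK]|min] :=
  pselect (exists2 b, lt b a & [set: K] #<= [set c | lt c b]).
  by apply: (IH b ba).
have [e [ea e_inj]] := card_le_inj k0 leK.
have eI : injective e by move=> x y; apply: e_inj.
have [wf' tot'] := wf_total_pullback lt e wf tot eI.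
(* A pulled-back segment below [x] embeds in the segment below [e x], which is small by minimality
   of [a] since [e x] precedes [a]. *)
exists (fun x y => lt (e x) (e y)); split=> // x /card_le_trans le.
apply: min; exists (e x); first exact: ea.
apply: le; apply: (@rel_card_le _ _ _ _ (fun x y => y = e x)) => [y yx|].
  by exists (e y).
by move=> y z w _ _ _ -> /eI.
Qed.

(** * Transfinite recursion and the disjoint dense sets *)

(** Since [step] passes to [G] only the set of earlier values, it respects pointwise equality, which
    is what unfolding [Fix] requires. *)
Lemma wf_recursion {T U : Type} (lt : T -> T -> Prop) (G : T -> set U -> U) :
  well_founded lt ->
  exists Z : T -> U, forall a, Z a = G a (Z @` [set b | lt b a]).
Proof.
move=> wf.
pose step a (Z : forall b, lt b a -> U) :=
  G a [set u | exists b (h : lt b a), Z b h = u].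
exists (Fix wf _ step) => a; rewrite Fix_eq.
  congr G; apply/seteqP; split=> [_ [b [h <-]]|_ [b h <-]]; first by exists b.
  by exists b, h.
move=> x f g fg; congr G; apply/seteqP.
by split=> _ [b [h <-]]; exists b, h; rewrite fg.
Qed.

Theorem lemma1p3 (X : topologicalType) (D : set X) (K : Type)
    (F : set (set X)) :
  dense D ->
  infinite_set [set: K] ->
  D #<= [set: K] ->
  (forall (x : X) (Y : set (set X)),
     D x -> small_disjoint_subfamilies K F Y ->
     exists Z : set X,
       [/\ F Z, (\bigcup_(A in Y) A) `&` Z = set0 & closure Z x]) ->
  resolvable K X.
Proof.
move=> Ddense Kinf DK HF.
have [k0 _] : [set: K] !=set0 by apply: infinite_setN0.
pose T : Type := ({x : X | D x} * K)%type.
have [lt [wf tot small]] :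
    exists lt : T -> T -> Prop,
    [/\ well_founded lt, forall x y, [\/ x = y, lt x y | lt y x] &
        forall a, card_lt [set b | lt b a] [set: K]].
  apply: (wf_small_segments k0).
  apply: card_le_trans _ (infinite_card_le_square K Kinf).
  have [d [_ d_inj]] := card_le_inj k0 DK.
  apply: (@rel_card_le _ _ _ _ (fun (p : T) q => q = (d (sval p.1), p.2))).
    by move=> p _; exists (d (sval p.1), p.2).
  move=> [[x Dx] k] [[y Dy] l] _ _ _ _ -> /= [/d_inj e ->].
  by congr pair; apply: eq_exist; apply: e.
(* [G] is made total by the default [set0]; the induction for [ZP] shows that every family met in
   the recursion is small and disjoint. *)
have /choice[G GP] (q : T * set (set X)) : exists Z : set X,
    small_disjoint_subfamilies K F q.2 ->
    [/\ F Z, (\bigcup_(A in q.2) A) `&` Z = set0 & closure Z (sval q.1.1)].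
  have [sm|nsm] := pselect (small_disjoint_subfamilies K F q.2).
    by have [Z ZP] := HF _ _ (svalP q.1.1) sm; exists Z.
  by exists set0.
have [Z ZE] := wf_recursion lt (fun a Y => G (a, Y)) wf.
have ZP a : [/\ F (Z a), forall b, lt b a -> Z b `&` Z a = set0 &
                closure (Z a) (sval a.1)].
  elim/(well_founded_induction wf): a => a IH.
  have [|FZ dZ clZ] := GP (a, Z @` [set b | lt b a]); last first.
    rewrite /= -ZE in FZ dZ clZ; split=> // b ba.
    apply/seteqP; split=> // x [Zb Za]; rewrite -dZ; split=> //.
    by exists (Z b) => //; exists b.
  (* The earlier sets form an admissible family: membership and disjointness come from the induction
     hypothesis, smallness from that of the segment below [a]. *)
  split=> /=.
  - by move=> _ [b ba <-]; have [] := IH b ba.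
  - have [le nge] := small a; split.
      exact: card_le_trans (card_image_le _ _) le.
    by move=> ge; apply: nge; exact: card_le_trans ge (card_image_le _ _).
  - move=> _ _ [b ba <-] [c ca <-] bc.
    have [e|lbc|lcb] := tot b c; first by rewrite e in bc.
      by have [_ /(_ b lbc)] := IH c ca.
    by rewrite setIC; have [_ /(_ c lcb)] := IH b ba.
have Zdisj a b : a <> b -> Z a `&` Z b = set0.
  move=> ab; have [//|lab|lba] := tot a b; first by have [_ ->] := ZP b.
  by rewrite setIC; have [_ ->] := ZP a.
exists (fun k => \bigcup_x Z (x, k)); split=> [k|i j ij].
  move=> O O0 Oo; have [x [Ox Dx]] := Ddense O O0 Oo.
  have [_ _ clZ] := ZP (exist _ x Dx, k).
  have [y [Zy Oy]] := clZ O (open_nbhs_nbhs (conj Oo Ox)).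
  by exists y; split=> //; exists (exist _ x Dx).
apply/seteqP; split=> // z [[x _ Zx] [y _ Zy]].
by rewrite -(Zdisj (x, i) (y, j)) // => -[].
Qed.
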